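(* Let $H$ be a finitely generated right $\mathbb{K}_\gamma[t^{\pm1}]$-module. Then $\mathrm{ord}(H)=0$ if and only if $H$ is not $\mathbb{K}_\gamma[t^{\pm1}]$-torsion. If $\mathrm{ord}(H)\neq0$, then $\mathrm{ord}(H)\in\mathbb{K}_\gamma[t^{\pm1}]$ is well-defined considered as an element in $\mathbb{K}_\gamma(t)^\times_{ab}$ up to multiplication by an element of the form $kt^e$ with $k\in\mathbb{K}\setminus\{0\}$ and $e\in\mathbb{Z}$ (that is, any two choices of $\mathrm{ord}(H)$ have the same image in $\mathbb{K}_\gamma(t)^\times_{ab}$ up to multiplication by the class of such a $kt^e$).
   Context: $\mathbb{K}$ is a (skew) field, $\gamma:\mathbb{K}\to\mathbb{K}$ is a ring automorphism, and $\mathbb{K}_\gamma[t^{\pm1}]$ is the skew Laurent polynomial ring: formal sums $\sum_{i=m}^na_it^i$ with $a_i\in\mathbb{K}$, with multiplication determined by $t^ia=\gamma^i(a)t^i$. It is a principal ideal domain and has a classical quotient skew field $\mathbb{K}_\gamma(t)$, whose elements have the form $f(t)g(t)^{-1}$. $\mathbb{K}_\gamma(t)^\times_{ab}$ denotes the abelianization of the multiplicative group $\mathbb{K}_\gamma(t)\setminus\{0\}$. For a finitely generated right $\mathbb{K}_\gamma[t^{\pm1}]$-module $H$, choose an isomorphism $H\cong\bigoplus_{i=1}^l\mathbb{K}_\gamma[t^{\pm1}]/p_i(t)\mathbb{K}_\gamma[t^{\pm1}]$ with $p_i(t)\in\mathbb{K}_\gamma[t^{\pm1}]$ and define the order $\mathrm{ord}(H)=\prod_{i=1}^lp_i(t)$.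 This depends on the choice of the isomorphism, of the $p_i(t)$ and of their ordering. *)

(* Defs.v *)
From HB Require Import structures.
From mathcomp Require Import all_boot all_order all_algebra.
From mathcomp Require Import finmap boolp monalg.

Set Implicit Arguments.
Unset Strict Implicit.
Unset Printing Implicit Defensive.

Import GRing.Theory.
Local Open Scope ring_scope.

(* Right R-modules are represented throughout by left modules over the        *)
(* converse ring R^c: in H : lmodType R^c, the element h r is (r : R^c) *: h. *)

Section AutomorphismPowers.
Variables (K : nzRingType) (gamma : {rmorphism K -> K}).
Hypothesis gamma_bij : bijective gamma.

Lemma aut_surj (y : K) : exists x, gamma x == y.
Proof. by case: gamma_bij => g _ gK; exists (g y); rewrite gK. Qed.

Definition aut_inv (y : K) : K := xchoose (aut_surj y).

Lemma aut_invK : cancel aut_inv gamma.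
Proof. by move=> y; apply/eqP; exact: (xchooseP (aut_surj y)). Qed.

Lemma autK : cancel gamma aut_inv.
Proof. by move=> x; apply: (bij_inj gamma_bij); rewrite aut_invK. Qed.

Definition autz (i : int) : K -> K :=
  match i with
  | Posz n => iter n gamma
  | Negz n => iter n.+1 aut_inv
  end.

Lemma autz_succ i a : autz (i + 1) a = gamma (autz i a).
Proof.
case: i => [n | [|n]].
- by rewrite -PoszD addn1.
- by rewrite /= aut_invK.
- have -> : Negz n.+1 + 1 = Negz n by rewrite !NegzE -[n.+2]addn1 PoszD opprD addrNK.
  by rewrite /= aut_invK.
Qed.

Lemma autzD i j a : autz (i + j) a = autz i (autz j a).
Proof.
elim/int_ind: i => [|n IH|n IH]; first by rewrite add0r.
- by rewrite -addn1 PoszD addrAC !autz_succ IH.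
- apply: (bij_inj gamma_bij); rewrite -!autz_succ addrAC.
  by rewrite -[n.+1]addn1 PoszD opprD addrNK IH.
Qed.

Lemma autz_is_zmod_morphism i : zmod_morphism (autz i).
Proof.
elim/int_ind: i => [|n IH|n IH] a b //.
- by rewrite -addn1 PoszD !autz_succ IH rmorphB.
- apply: (bij_inj gamma_bij); rewrite rmorphB -!autz_succ.
  by rewrite -[n.+1]addn1 PoszD opprD addrNK IH.
Qed.

HB.instance Definition _ i :=
  GRing.isZmodMorphism.Build K K (autz i) (autz_is_zmod_morphism i).

Lemma autz_is_monoid_morphism i : monoid_morphism (autz i).
Proof.
elim/int_ind: i => [|n [IH1 IHM]|n [IH1 IHM]]; first by split.
- by split=> [|a b]; rewrite -addn1 PoszD !autz_succ ?IH1 ?IHM ?rmorph1 ?rmorphM.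
- have E : - n.+1%:Z + 1 = - n%:Z by rewrite -[n.+1]addn1 PoszD opprD addrNK.
  by split=> [|a b]; apply: (bij_inj gamma_bij);
     rewrite ?rmorph1 ?rmorphM -!autz_succ E ?IH1 ?IHM.
Qed.

HB.instance Definition _ i :=
  GRing.isMonoidMorphism.Build K K (autz i) (autz_is_monoid_morphism i).

End AutomorphismPowers.

(* {malg K[int]} is the additive group of finitely supported functions        *)
(* int -> K; the single-term function << a *g i >> is the monomial a t^i.     *)
Definition skew_laurent (K : nzRingType) (gamma : {rmorphism K -> K})
  (gamma_bij : bijective gamma) : Type := {malg K[int]}.

Section SkewLaurent.
Variables (K : nzRingType) (gamma : {rmorphism K -> K}).
Hypothesis gamma_bij : bijective gamma.
Local Notation L := (skew_laurent gamma_bij).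
Local Notation autz := (autz gamma_bij).
Local Open Scope fset_scope.
Local Open Scope ring_scope.

HB.instance Definition _ := GRing.Zmodule.copy L {malg K[int]}.

Definition laurent_mono (a : K) (i : int) : L := << a *g i >>.

Definition laurent_mul (f g : L) : L :=
  \sum_(i <- msupp f) \sum_(j <- msupp g)
    laurent_mono (f@_i * autz i g@_j) (i + j).

Lemma laurent_mono0 i : laurent_mono 0 i = 0.
Proof. exact: monalgU0. Qed.

Lemma laurent_monoD i a b :
  laurent_mono (a + b) i = laurent_mono a i + laurent_mono b i.
Proof. exact: monalgUD. Qed.

Lemma laurent_mulEw (d1 d2 : {fset int}) (f g : L) :
  msupp f `<=` d1 -> msupp g `<=` d2 ->
  laurent_mul f g = \sum_(i <- d1) \sum_(j <- d2)
    laurent_mono (f@_i * autz i g@_j) (i + j).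
Proof.
move=> le1 le2; transitivity (\sum_(i <- d1) \sum_(j <- msupp g)
    laurent_mono (f@_i * autz i g@_j) (i + j)).
  apply: big_fset_incl => // i _ /mcoeff_outdom ->.
  by rewrite big1 // => j _; rewrite mul0r laurent_mono0.
apply: eq_bigr => i _; apply: big_fset_incl => // j _ /mcoeff_outdom ->.
by rewrite raddf0 mulr0 laurent_mono0.
Qed.

Lemma laurent_mul_mono a b i j :
  laurent_mul (laurent_mono a i) (laurent_mono b j)
  = laurent_mono (a * autz i b) (i + j).
Proof.
rewrite (laurent_mulEw (msuppU_le (k := i)) (msuppU_le (k := j))).
by rewrite !big_seq_fset1 !mcoeffUU.
Qed.

Lemma laurentE (f : L) : f = \sum_(i <- msupp f) laurent_mono f@_i i.
Proof. exact: monalgE. Qed.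

Lemma laurent_mulDl : left_distributive laurent_mul +%R.
Proof.
move=> f1 f2 g; pose d := msupp f1 `|` msupp f2.
rewrite (laurent_mulEw (d1 := d) (f := f1) (fsubsetUl _ _) (fsubset_refl _)).
rewrite (laurent_mulEw (d1 := d) (f := f2) (fsubsetUr _ _) (fsubset_refl _)).
rewrite (laurent_mulEw (d1 := d) (msuppD_le _ _) (fsubset_refl _)).
rewrite -big_split; apply: eq_bigr => i _; rewrite -big_split.
by apply: eq_bigr => j _; rewrite mcoeffD mulrDl laurent_monoD.
Qed.

Lemma laurent_mulDr : right_distributive laurent_mul +%R.
Proof.
move=> f g1 g2; pose d := msupp g1 `|` msupp g2.
rewrite (laurent_mulEw (d2 := d) (g := g1) (fsubset_refl _) (fsubsetUl _ _)).
rewrite (laurent_mulEw (d2 := d) (g := g2) (fsubset_refl _) (fsubsetUr _ _)).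
rewrite (laurent_mulEw (d2 := d) (fsubset_refl _) (msuppD_le _ _)).
rewrite -big_split; apply: eq_bigr => i _; rewrite -big_split.
by apply: eq_bigr => j _; rewrite mcoeffD raddfD mulrDr laurent_monoD.
Qed.

Lemma laurent_mul0l : left_zero 0 laurent_mul.
Proof. by move=> f; apply: (addrI (laurent_mul 0 f)); rewrite -laurent_mulDl !addr0. Qed.

Lemma laurent_mul0r : right_zero 0 laurent_mul.
Proof. by move=> f; apply: (addrI (laurent_mul f 0)); rewrite -laurent_mulDr !addr0. Qed.

Lemma laurent_mul_suml (I : Type) (r : seq I) (F : I -> L) g :
  laurent_mul (\sum_(i <- r) F i) g = \sum_(i <- r) laurent_mul (F i) g.
Proof.
apply: (big_morph (laurent_mul^~ g)) => [f1 f2|]; last exact: laurent_mul0l.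
exact: laurent_mulDl.
Qed.

Lemma laurent_mul_sumr (I : Type) (r : seq I) (F : I -> L) f :
  laurent_mul f (\sum_(i <- r) F i) = \sum_(i <- r) laurent_mul f (F i).
Proof.
apply: (big_morph (laurent_mul f)) => [g1 g2|]; last exact: laurent_mul0r.
exact: laurent_mulDr.
Qed.

Lemma laurent_mulA : associative laurent_mul.
Proof.
move=> f g h.
rewrite (laurentE f) !laurent_mul_suml; apply: eq_bigr => i _.
rewrite (laurentE g) laurent_mul_suml !laurent_mul_sumr laurent_mul_suml.
apply: eq_bigr => j _.
rewrite (laurentE h) !laurent_mul_sumr; apply: eq_bigr => k _.
by rewrite !laurent_mul_mono rmorphM /= -autzD mulrA addrA.
Qed.

Lemma laurent_mul1l : left_id (laurent_mono 1 0) laurent_mul.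
Proof.
move=> f; rewrite [in LHS](laurentE f) laurent_mul_sumr [RHS]laurentE.
by apply: eq_bigr => i _; rewrite laurent_mul_mono mul1r add0r.
Qed.

Lemma laurent_mul1r : right_id (laurent_mono 1 0) laurent_mul.
Proof.
move=> f; rewrite [in LHS](laurentE f) laurent_mul_suml [RHS]laurentE.
by apply: eq_bigr => i _; rewrite laurent_mul_mono rmorph1 mulr1 addr0.
Qed.

Lemma laurent_mono_eq0 a i : (laurent_mono a i == 0) = (a == 0).
Proof. exact: monalgU_eq0. Qed.

Lemma laurent_mono_neq0 a i : a != 0 -> laurent_mono a i != 0.
Proof. by rewrite laurent_mono_eq0. Qed.

Lemma laurent_oner_neq0 : laurent_mono 1 0 != 0.
Proof. exact: laurent_mono_neq0 (oner_neq0 K). Qed.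

HB.instance Definition _ := GRing.Zmodule_isNzRing.Build L
  laurent_mulA laurent_mul1l laurent_mul1r laurent_mulDl laurent_mulDr
  laurent_oner_neq0.

End SkewLaurent.

Arguments laurent_mono {K gamma} gamma_bij a i.
Arguments laurent_mono_neq0 {K gamma} gamma_bij {a} i _.

Section RightModules.
Variable R : nzRingType.

Definition right_ideal (p : R) : {pred R} := fun x => `[< exists r, x = p * r >].

Lemma right_ideal_zmod_closed p : zmod_closed (right_ideal p).
Proof.
split=> [|x y]; first by apply/asboolP; exists 0; rewrite mulr0.
by move=> /asboolP[r ->] /asboolP[s ->]; apply/asboolP; exists (r - s); rewrite mulrBr.
Qed.

HB.instance Definition _ p :=
  GRing.isZmodClosed.Build R (right_ideal p) (right_ideal_zmod_closed p).

Definition cyclic_module (p : R) : Type := Quotient.quot (right_ideal p).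

Section CyclicModule.
Variable p : R.
Local Notation M := (cyclic_module p).
Local Open Scope quotient_scope.

HB.instance Definition _ := GRing.Zmodule.on M.

Definition cyclic_class (x : R) : M := \pi_(Quotient.quot (right_ideal p)) x.

Definition cyclic_scale (r : R^c) (m : M) : M :=
  cyclic_class (repr (m : Quotient.quot (right_ideal p)) * (r : R)).

Lemma cyclic_classK (m : M) : cyclic_class (repr (m : Quotient.quot (right_ideal p))) = m.
Proof. exact: reprK. Qed.

Lemma cyclic_class_eq (x y : R) :
  cyclic_class x = cyclic_class y <-> exists r, x - y = p * r.
Proof.
split=> [/eqP|H]; first by rewrite -Quotient.idealrBE => /asboolP.
by apply/eqP; rewrite -Quotient.idealrBE; apply/asboolP.
Qed.

Lemma cyclic_class_is_zmod_morphism : zmod_morphism cyclic_class.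
Proof. by move=> x y; rewrite /cyclic_class !piE. Qed.

HB.instance Definition _ :=
  GRing.isZmodMorphism.Build R M cyclic_class cyclic_class_is_zmod_morphism.

Lemma cyclic_scaleE (r : R^c) (x : R) :
  cyclic_scale r (cyclic_class x) = cyclic_class (x * (r : R)).
Proof.
apply/cyclic_class_eq; rewrite -mulrBl.
have /cyclic_class_eq[s ->] := cyclic_classK (cyclic_class x).
by exists (s * (r : R)); rewrite mulrA.
Qed.

Lemma cyclic_scaleA (a b : R^c) m :
  cyclic_scale a (cyclic_scale b m) = cyclic_scale (a * b) m.
Proof. by rewrite -[m]cyclic_classK !cyclic_scaleE -mulrA. Qed.

Lemma cyclic_scale1 : left_id (1 : R^c) cyclic_scale.
Proof. by move=> m; rewrite -[m]cyclic_classK cyclic_scaleE mulr1. Qed.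

Lemma cyclic_scaleDr : right_distributive cyclic_scale +%R.
Proof.
move=> a m n; rewrite -[m]cyclic_classK -[n]cyclic_classK -raddfD.
by rewrite !cyclic_scaleE mulrDl raddfD.
Qed.

Lemma cyclic_scaleDl m : {morph cyclic_scale^~ m : a b / a + b}.
Proof.
by move=> a b; rewrite -[m]cyclic_classK !cyclic_scaleE mulrDr raddfD.
Qed.

HB.instance Definition _ := GRing.Zmodule_isLmodule.Build R^c M
  cyclic_scaleA cyclic_scale1 cyclic_scaleDr cyclic_scaleDl.

End CyclicModule.

End RightModules.

Section DirectSum.
Variables (S : nzRingType) (l : nat) (V : 'I_l -> lmodType S).

Definition direct_sum : Type := {dffun forall i : 'I_l, V i}.

HB.instance Definition _ := Choice.on direct_sum.

Definition dsum0 : direct_sum := [ffun i => 0 : V i].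
Definition dsum_opp (u : direct_sum) : direct_sum := [ffun i => - u i : V i].
Definition dsum_add (u v : direct_sum) : direct_sum := [ffun i => u i + v i : V i].
Definition dsum_scale (a : S) (u : direct_sum) : direct_sum :=
  [ffun i => a *: u i : V i].

Lemma dsum_addA : associative dsum_add.
Proof. by move=> u v w; apply/ffunP => i; rewrite !ffunE addrA. Qed.
Lemma dsum_addC : commutative dsum_add.
Proof. by move=> u v; apply/ffunP => i; rewrite !ffunE addrC. Qed.
Lemma dsum_add0 : left_id dsum0 dsum_add.
Proof. by move=> u; apply/ffunP => i; rewrite !ffunE add0r. Qed.
Lemma dsum_addN : left_inverse dsum0 dsum_opp dsum_add.
Proof. by move=> u; apply/ffunP => i; rewrite !ffunE addNr. Qed.

HB.instance Definition _ :=
  GRing.isZmodule.Build direct_sum dsum_addA dsum_addC dsum_add0 dsum_addN.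

Lemma dsum_scaleA a b u : dsum_scale a (dsum_scale b u) = dsum_scale (a * b) u.
Proof. by apply/ffunP => i; rewrite !ffunE scalerA. Qed.
Lemma dsum_scale1 : left_id 1 dsum_scale.
Proof. by move=> u; apply/ffunP => i; rewrite !ffunE scale1r. Qed.
Lemma dsum_scaleDr : right_distributive dsum_scale +%R.
Proof. by move=> a u v; apply/ffunP => i; rewrite !ffunE scalerDr. Qed.
Lemma dsum_scaleDl u : {morph dsum_scale^~ u : a b / a + b}.
Proof. by move=> a b; apply/ffunP => i; rewrite !ffunE scalerDl. Qed.

HB.instance Definition _ := GRing.Zmodule_isLmodule.Build S direct_sum
  dsum_scaleA dsum_scale1 dsum_scaleDr dsum_scaleDl.

End DirectSum.

Definition finitely_generated (S : nzRingType) (H : lmodType S) : Prop :=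
  exists (n : nat) (s : 'I_n -> H),
    forall h : H, exists a : 'I_n -> S, h = \sum_(i < n) a i *: s i.

Section Order.
Variables (R : nzRingType) (H : lmodType R^c).

Definition torsion_module : Prop :=
  forall h : H, exists2 r : R, r != 0 & (r : R^c) *: h = 0.

(* d is one of the possible values of ord(H). The product is taken in R, in   *)
(* increasing order of the indices.                                           *)
Definition is_order (d : R) : Prop :=
  exists (l : nat) (p : 'I_l -> R)
         (phi : {linear H -> direct_sum (fun i => cyclic_module (p i) : lmodType R^c)}),
    bijective phi /\ d = \prod_(i < l) p i.

End Order.

Section UnitGroup.
Variable Q : unitRingType.

Definition unit_group : Type := {x : Q | x \is a GRing.unit}.

HB.instance Definition _ := Choice.on unit_group.

Lemma ug_mul_unit (x y : unit_group) : sval x * sval y \is a GRing.unit.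
Proof. by rewrite unitrMl (svalP x, svalP y). Qed.

Lemma ug_inv_unit (x : unit_group) : (sval x)^-1 \is a GRing.unit.
Proof. by rewrite unitrV (svalP x). Qed.

Definition ug_one : unit_group := exist _ 1 (unitr1 Q).
Definition ug_mul (x y : unit_group) : unit_group :=
  exist _ (sval x * sval y) (ug_mul_unit x y).
Definition ug_inv (x : unit_group) : unit_group :=
  exist _ (sval x)^-1 (ug_inv_unit x).

Lemma ug_mulA : associative ug_mul.
Proof. by move=> x y z; apply: val_inj; rewrite /= mulrA. Qed.
Lemma ug_mul1 : left_id ug_one ug_mul.
Proof. by move=> x; apply: val_inj; rewrite /= mul1r. Qed.
Lemma ug_mulr1 : right_id ug_one ug_mul.
Proof. by move=> x; apply: val_inj; rewrite /= mulr1. Qed.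
Lemma ug_mulV : left_inverse ug_one ug_inv ug_mul.
Proof. by move=> x; apply: val_inj; rewrite /= mulVr ?(svalP x). Qed.
Lemma ug_mulrV : right_inverse ug_one ug_inv ug_mul.
Proof. by move=> x; apply: val_inj; rewrite /= divrr ?(svalP x). Qed.

HB.instance Definition _ :=
  isGroup.Build unit_group ug_mulA ug_mul1 ug_mulr1 ug_mulV ug_mulrV.

End UnitGroup.

Section Abelianization.
Variable G : groupType.
Local Open Scope group_scope.
Local Open Scope quotient_scope.

Inductive derived_subgroup : G -> Prop :=
  | derived_comm x y : derived_subgroup [~ x, y]
  | derived_one : derived_subgroup 1
  | derived_mul x y :
      derived_subgroup x -> derived_subgroup y -> derived_subgroup (x * y)
  | derived_inv x : derived_subgroup x -> derived_subgroup x^-1.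

Lemma derived_conj x y : derived_subgroup x -> derived_subgroup (x ^ y).
Proof.
move=> dx; have -> : x ^ y = x * [~ x, y] by rewrite commgEl mulVKg.
exact: derived_mul dx (derived_comm x y).
Qed.

Definition ab_equiv (x y : G) : bool := `[< derived_subgroup (x^-1 * y) >].

Lemma ab_equiv_refl : reflexive ab_equiv.
Proof. by move=> x; apply/asboolP; rewrite mulVg; exact: derived_one. Qed.

Lemma ab_equiv_sym : symmetric ab_equiv.
Proof.
have H x y : ab_equiv x y -> ab_equiv y x.
  by move=> /asboolP/derived_inv; rewrite invgM invgK => ?; apply/asboolP.
by move=> x y; apply/idP/idP; exact: H.
Qed.

Lemma ab_equiv_trans : transitive ab_equiv.
Proof.
move=> y x z /asboolP dxy /asboolP dyz; apply/asboolP.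
by have := derived_mul dxy dyz; rewrite -mulgA mulVKg.
Qed.

Canonical ab_equiv_rel := EquivRel ab_equiv ab_equiv_refl ab_equiv_sym ab_equiv_trans.

Definition abelianization : Type := {eq_quot ab_equiv}.

HB.instance Definition _ := EqQuotient.on abelianization.
HB.instance Definition _ := Choice.on abelianization.

Definition ab_class (x : G) : abelianization := \pi_abelianization x.

Lemma ab_class_eq x y : ab_class x = ab_class y <-> derived_subgroup (x^-1 * y).
Proof. by split=> [/eqquotP/asboolP|H] //; apply/eqquotP/asboolP. Qed.

Definition ab_one : abelianization := ab_class 1.
Definition ab_inv (c : abelianization) : abelianization := ab_class (repr c)^-1.
Definition ab_mul (c d : abelianization) : abelianization :=
  ab_class (repr c * repr d).

Lemma ab_classK (c : abelianization) : ab_class (repr c) = c.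
Proof. exact: reprK. Qed.

Lemma ab_classM_comm x y : ab_class (x * y) = ab_class (y * x).
Proof.
by apply/ab_class_eq; rewrite invgM -mulgA; exact: (derived_comm y x).
Qed.

Lemma ab_classMl x x' y : ab_class x = ab_class x' -> ab_class (x * y) = ab_class (x' * y).
Proof.
move=> /ab_class_eq/(derived_conj y) H; apply/ab_class_eq.
by move: H; rewrite conjgE invgM !mulgA.
Qed.

Lemma ab_mulE x y : ab_mul (ab_class x) (ab_class y) = ab_class (x * y).
Proof.
rewrite /ab_mul (ab_classMl _ (ab_classK _)) ab_classM_comm.
by rewrite (ab_classMl _ (ab_classK _)) ab_classM_comm.
Qed.

Lemma ab_mulA : associative ab_mul.
Proof.
move=> a b c; rewrite -[a]ab_classK -[b]ab_classK -[c]ab_classK.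
by rewrite !ab_mulE mulgA.
Qed.

Lemma ab_mulC : commutative ab_mul.
Proof.
by move=> a b; rewrite -[a]ab_classK -[b]ab_classK !ab_mulE ab_classM_comm.
Qed.

Lemma ab_mul1 : left_id ab_one ab_mul.
Proof. by move=> a; rewrite -[a]ab_classK ab_mulE mul1g. Qed.

Lemma ab_mulr1 : right_id ab_one ab_mul.
Proof. by move=> a; rewrite ab_mulC ab_mul1. Qed.

Lemma ab_mulV : left_inverse ab_one ab_inv ab_mul.
Proof. by move=> a; rewrite -[in X in ab_mul _ X](ab_classK a) ab_mulE mulVg. Qed.

Lemma ab_mulrV : right_inverse ab_one ab_inv ab_mul.
Proof. by move=> a; rewrite ab_mulC ab_mulV. Qed.

HB.instance Definition _ :=
  isGroup.Build abelianization ab_mulA ab_mul1 ab_mulr1 ab_mulV ab_mulrV.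

Lemma ab_classM : {morph ab_class : x y / x * y}.
Proof. by move=> x y; rewrite -ab_mulE. Qed.

End Abelianization.

Record quotient_skew_field (R : nzRingType) (Q : unitRingType)
    (iota : {rmorphism R -> Q}) : Prop := {
  qf_field : GRing.field_axiom Q;
  qf_inj : injective iota;
  qf_frac : forall q : Q, exists f g : R, g != 0 /\ q = iota f * (iota g)^-1
}.

Section FractionClass.
Variables (R : nzRingType) (Q : unitRingType) (iota : {rmorphism R -> Q}).
Hypothesis hQ : quotient_skew_field iota.

Lemma frac_unit (f : R) : f != 0 -> iota f \is a GRing.unit.
Proof.
move=> f0; apply: (qf_field hQ); apply: contra f0 => /eqP f0.
by apply/eqP/(qf_inj hQ); rewrite f0 rmorph0.
Qed.

Definition frac_class (f : R) (f_neq0 : f != 0) : abelianization (unit_group Q) :=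
  ab_class (exist _ (iota f) (frac_unit f_neq0) : unit_group Q).

End FractionClass.

(* Main.v *)
(* Attach to a sequence of generators e_1, ..., e_n of H the product of the   *)
(* classes of a_1, ..., a_n, where a_k generates the right ideal              *)
(* {r | e_k r \in e_1 R + ... + e_(k-1) R}. For the standard generators of a  *)
(* sum of cyclic modules R / p_i R this product is the class of the order.    *)
(* It is determined up to units, it is unchanged when two neighbouring        *)
(* generators are exchanged, and appending redundant generators only adds     *)
(* factors 1. Comparing s ++ t with t ++ s, two generating sequences s and t  *)
(* thus give the same product up to units, and the units of the skew Laurent  *)
(* ring are the monomials k t^e with k != 0.                                  *)

Require Import Defs.
From mathcomp Require Import all_boot all_order all_algebra.
From mathcomp Require Import finmap boolp monalg.
From mathcomp Require Import zify.
From Stdlib Require Import Permutation.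

Set Implicit Arguments.
Unset Strict Implicit.
Unset Printing Implicit Defensive.

Import GRing.Theory.
Local Open Scope ring_scope.

(** The skew Laurent ring [R] embeds in a skew field, so it is a domain and a product of the [p i]
    vanishes exactly when some [p i] does. A summand with [p i = 0] is a copy of [R], which is not
    torsion; if all [p i] are nonzero, the right Ore condition ([right_ore]) provides nonzero
    annihilators.

    For uniqueness, let [chi] be the class of a nonzero element in the abelianized unit group.
    [chain_order] measures a generating sequence by multiplying the values of [chi] at generators of
    its successive colon ideals. The core is invariance under exchanging neighbours
    ([chain_order_swap]), which rests on [gcd_colon]: R/aR contains (aR+cR)/aR, isomorphic to R/uR,
    with quotient R/gR, and correspondingly [chi a] is [chi g * chi u]. This multiplicativity
    follows from Euclid's algorithm, available through [laurent_right_division]. Two cyclic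
    decompositions give two generating sequences, which [chain_order_generators_unique] compares up
    to units; [laurent_unit_mono] identifies the units. *)

(** * Coefficients and supports of skew Laurent polynomials *)

Section LaurentCoefficients.
Variables (K : nzRingType) (gamma : {rmorphism K -> K}).
Hypothesis gamma_bij : bijective gamma.
Local Notation L := (skew_laurent gamma_bij).
Local Notation autz := (autz gamma_bij).

Lemma laurent_coefB (f g : L) (k : int) : (f - g : L)@_k = f@_k - g@_k.
Proof. exact: mcoeffB. Qed.

Lemma laurent_coef_mono (a : K) (i k : int) :
  (laurent_mono gamma_bij a i)@_k = a *+ (i == k).
Proof. exact: mcoeffU. Qed.

Lemma laurent_coef_sum (I : Type) (r : seq I) (F : I -> L) (k : int) :
  (\sum_(i <- r) F i : L)@_k = \sum_(i <- r) (F i)@_k.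
Proof.
apply: (big_morph (fun f : L => f@_k)) => [f g|]; first exact: mcoeffD.
exact: mcoeff0.
Qed.

Lemma laurent_mono_mul (a b : K) (i j : int) :
  laurent_mono gamma_bij a i * laurent_mono gamma_bij b j =
  laurent_mono gamma_bij (a * autz i b) (i + j).
Proof. exact: laurent_mul_mono. Qed.

Lemma laurent_coef_mulmono (f : L) (b : K) (i j k : int) : i + j = k ->
  (f * laurent_mono gamma_bij b j)@_k = f@_i * autz i b.
Proof.
move=> <-; rewrite {1}(laurentE f) mulr_suml laurent_coef_sum.
under eq_bigr => m _ do rewrite laurent_mono_mul laurent_coef_mono.
rewrite (eq_bigr (fun m => if m == i then f@_m * autz m b else 0)); last first.
  by move=> m _; rewrite (inj_eq (addIr j)); case: eqP.
case: (boolP (i \in msupp f)) => [fi|/mcoeff_outdom fi0].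
  rewrite (big_fsetD1 i fi) /= eqxx big1_seq ?addr0 // => m /andP[_].
  by rewrite !inE; case: eqP.
by rewrite fi0 mul0r big1 // => m _; case: eqP => // ->; rewrite fi0 mul0r.
Qed.

Lemma laurent_coef_mul (f g : L) (k : int) :
  (f * g)@_k = \sum_(j <- msupp g) f@_(k - j) * autz (k - j) g@_j.
Proof.
rewrite {1}(laurentE g) mulr_sumr laurent_coef_sum.
by apply: eq_bigr => j _; rewrite (laurent_coef_mulmono f _ (subrK j k)).
Qed.

Definition supp_within (f : L) (m : int) (n : nat) : Prop :=
  forall i : int, f@_i != 0 -> (m <= i < m + n%:Z)%R.

(** The Euclidean size: a bound on the number of consecutive exponents, not on a degree, since
    multiplying by a power of t must not change it. Bound 0 forces [f = 0]. *)
Definition width_le (n : nat) (f : L) : Prop := exists m, supp_within f m n.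

Lemma laurent_ext (f g : L) : (forall i, f@_i = g@_i) -> f = g.
Proof. by move=> fg; apply/malgP. Qed.

Lemma width_le0 (f : L) : width_le 0 f -> f = 0.
Proof.
move=> [m fm]; apply: laurent_ext => i; rewrite [RHS]mcoeff0.
by apply/eqP; apply: contraT => /fm; lia.
Qed.

Lemma supp_withinW (f : L) (m m' : int) (n n' : nat) :
  (m' <= m)%R -> (m + n%:Z <= m' + n'%:Z)%R ->
  supp_within f m n -> supp_within f m' n'.
Proof. by move=> le1 le2 fm i /fm; lia. Qed.

Lemma width_le_exists (f : L) : exists n, width_le n f.
Proof.
pose N := (\sum_(i <- msupp f) `|i|)%N.
exists (N + N).+1, (- N%:Z) => i; rewrite mcoeff_neq0 => fi.
have : (`|i| <= N)%N.
  by rewrite /N (big_fsetD1 i fi) /= leq_addr.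
lia.
Qed.

Lemma supp_within_exact (f : L) : f != 0 ->
  exists m n, [/\ supp_within f m n.+1, f@_m != 0 & f@_(m + n%:Z) != 0].
Proof.
move=> f0; have [N] := width_le_exists f.
elim: N => [/width_le0 /eqP|n IHn [m fm]]; first by rewrite (negPf f0).
case: (eqVneq f@_m 0) => [fm0|fm0].
  apply: IHn; exists (m + 1) => i fi; have := fm i fi.
  have : i != m by apply: contraNneq fi => ->; apply/eqP.
  lia.
case: (eqVneq f@_(m + n%:Z) 0) => [fn0|fn0]; last by exists m, n.
apply: IHn; exists m => i fi; have := fm i fi.
have : i != m + n%:Z by apply: contraNneq fi => ->; apply/eqP.
lia.
Qed.

(** Meant for extreme exponents, where only one pair of terms contributes to the product. *)
Lemma laurent_coef_mul_single (f g : L) (i j : int) :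
  (forall k, k != j -> (f@_(i + j - k) == 0) || (g@_k == 0)) ->
  (f * g)@_(i + j) = f@_i * autz i g@_j.
Proof.
move=> fg; rewrite laurent_coef_mul.
have term0 k : k != j -> f@_(i + j - k) * autz (i + j - k) g@_k = 0.
  by move=> /fg /orP[] /eqP ->; rewrite ?mul0r ?rmorph0 ?mulr0.
case: (boolP (j \in msupp g)) => [gj|gj].
  rewrite (big_fsetD1 j gj) /= addrK big1_seq ?addr0 // => k /andP[_].
  by rewrite !inE => /andP[kj _]; exact: term0.
rewrite (mcoeff_outdom gj) rmorph0 mulr0 big1_seq // => k /andP[_ gk].
by apply: term0; apply: contraNneq gj => <-.
Qed.

End LaurentCoefficients.

(** * Division with remainder and units over a skew field *)

Section LaurentSkewField.
Variables (K : unitRingType) (gamma : {rmorphism K -> K}).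
Hypothesis K_skew_field : GRing.field_axiom K.
Hypothesis gamma_bij : bijective gamma.
Local Notation L := (skew_laurent gamma_bij).
Local Notation autz := (autz gamma_bij).

Lemma skew_mulf_neq0 (x y : K) : x != 0 -> y != 0 -> x * y != 0.
Proof.
move=> /K_skew_field xu y0; apply: contra y0 => /eqP xy0.
by rewrite -(mulKr xu y) xy0 mulr0.
Qed.

Lemma autz_neq0 (i : int) (x : K) : x != 0 -> autz i x != 0.
Proof.
apply: contraNneq => /(congr1 (autz (- i))); rewrite -autzD addNr rmorph0.
by move=> /= ->.
Qed.

Lemma laurent_right_division (n : nat) (a c : L) :
  width_le n.+1 a -> a != 0 -> exists q, width_le n (c - a * q).
Proof.
move=> [m0 am0] a0; have [m [n' [am a_low a_top]]] := supp_within_exact a0.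
have le_n'n : (n' <= n)%N by have := am0 _ a_low; have := am0 _ a_top; lia.
have [N] := width_le_exists c.
elim: N c => [|N IHN] c [l cl].
  by exists 0, l; rewrite mulr0 subr0; apply: supp_withinW cl => //; lia.
have [le_Nn|lt_nN] := leqP N.+1 n.
  by exists 0, l; rewrite mulr0 subr0; apply: supp_withinW cl => //; lia.
(* [k] is the top exponent of [a]. Moving [x] past t^k applies the k-th power of [gamma], so [x] is
   twisted back by [autz (- k)] to make the product cancel the coefficient of [c] at [l + N]. *)
pose k : int := m + n'%:Z; pose j : int := l + N%:Z - k.
pose x := autz (- k) ((a@_k)^-1 * c@_(l + N%:Z)).
pose c' : L := c - a * laurent_mono gamma_bij x j.
have c'E i : c'@_i = c@_i - a@_(i - j) * autz (i - j) x.
  by rewrite laurent_coefB (laurent_coef_mulmono a x (subrK j i)).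
have [|q c'q] := IHN c'; last first.
  exists (laurent_mono gamma_bij x j + q).
  by rewrite mulrDr opprD addrA.
exists l => i c'i.
have : i != l + N%:Z.
  apply: contraNneq c'i => ->; rewrite c'E.
  have -> : l + N%:Z - j = k by rewrite /j; lia.
  rewrite -autzD addrN /= mulrA divrr ?mul1r ?subrr //.
  exact: K_skew_field.
(* The subtracted product starts at exponent [l + N - n'], which is at least [l] because
   [n' <= n <= N]; hence nothing appears below [l]. *)
have : (c@_i != 0) || (a@_(i - j) != 0).
  apply: contraNT c'i; rewrite negb_or !negbK => /andP[/eqP ci /eqP ai].
  by rewrite c'E ci ai mul0r subrr.
by case/orP => [/cl|/am]; rewrite /j /k; lia.
Qed.

(** The lowest terms of [f] and [g] multiply to a nonzero term, and so do the highest ones. In 1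
    both must sit at exponent 0, so the two widths add up to nothing and [f] has a single term. *)
Lemma laurent_unit_mono (f g : L) : f * g = 1 ->
  exists (k : K) (e : int), k != 0 /\ f = laurent_mono gamma_bij k e.
Proof.
move=> fg1.
have f0 : f != 0 by apply: contra_eq_neq fg1 => ->; rewrite mul0r eq_sym oner_eq0.
have g0 : g != 0 by apply: contra_eq_neq fg1 => ->; rewrite mulr0 eq_sym oner_eq0.
have [m [n [fm f_low f_top]]] := supp_within_exact f0.
have [m' [n' [gm g_low g_top]]] := supp_within_exact g0.
have prod0 i j : f@_i != 0 -> g@_j != 0 ->
    (forall k, k != j -> (f@_(i + j - k) == 0) || (g@_k == 0)) -> i + j = 0.
  move=> fi gj ij; have := laurent_coef_mul_single ij.
  rewrite fg1 [LHS]laurent_coef_mono; case: eqP => // _ /esym /eqP.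
  by rewrite (negPf (skew_mulf_neq0 fi (autz_neq0 i gj))).
have low0 : m + m' = 0.
  apply: prod0 => // k km'; apply/orP; case: eqP => [|/eqP/fm fk]; first by left.
  by right; apply: contraT => /gm gk; lia.
have top0 : m + n%:Z + (m' + n'%:Z) = 0.
  apply: prod0 => // k km'; apply/orP; case: eqP => [|/eqP/fm fk]; first by left.
  by right; apply: contraT => /gm gk; lia.
exists f@_m, m; split=> //; apply: laurent_ext => i; rewrite laurent_coef_mono.
case: (eqVneq m i) => [<- //|mi]; apply/eqP; apply: contraT => /fm; lia.
Qed.

End LaurentSkewField.

Lemma prod_factor_neq0 (R : nzRingType) (l : nat) (p : 'I_l -> R) :
  \prod_(i < l) p i != 0 -> forall i, p i != 0.
Proof.
elim: l p => [p _ [] //|l IHl p]; rewrite big_ord_recl => pr i.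
case: (unliftP ord0 i) => [j ->|->].
  by apply: (IHl (fun j => p (lift ord0 j))); apply: contraNneq pr => ->; rewrite mulr0.
by apply: contraNneq pr => ->; rewrite mul0r.
Qed.

(** * Right action and spans of finite sequences *)

Section RightAction.
Variables (R : nzRingType) (H : lmodType R^c).

Definition ract (h : H) (r : R) : H := (r : R^c) *: h.

Lemma ractM h r s : ract (ract h r) s = ract h (r * s).
Proof. by rewrite /ract scalerA. Qed.
Lemma ractDr h r s : ract h (r + s) = ract h r + ract h s.
Proof. exact: (scalerDl h (r : R^c) (s : R^c)). Qed.
Lemma ractBr h r s : ract h (r - s) = ract h r - ract h s.
Proof. exact: (scalerBl (r : R^c) (s : R^c) h). Qed.
Lemma ractBl h h' r : ract (h - h') r = ract h r - ract h' r.
Proof. exact: (scalerBr (r : R^c) h h'). Qed.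
Lemma ract0r h : ract h 0 = 0.
Proof. exact: (scale0r h). Qed.
Lemma ract0l r : ract 0 r = 0.
Proof. exact: (scaler0 H (r : R^c)). Qed.
(** Recursion on the list peels off one coefficient at a time, matching the steps of the filtration
    used for colon ideals. *)
Fixpoint span (s : seq H) (h : H) : Prop :=
  if s is e :: s' then exists r, span s' (h - ract e r) else h = 0.

Lemma span0 s : span s 0.
Proof. by elim: s => //= e s IHs; exists 0; rewrite ract0r subr0. Qed.

Lemma spanB s h h' : span s h -> span s h' -> span s (h - h').
Proof.
elim: s h h' => [|e s IHs] h h' /=; first by move=> -> ->; rewrite subr0.
move=> [r hr] [r' hr']; exists (r - r'); rewrite ractBr.
have -> : h - h' - (ract e r - ract e r') = h - ract e r - (h' - ract e r').
  by rewrite !opprD !opprK addrACA.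
exact: IHs.
Qed.

Lemma span_ract s h r : span s h -> span s (ract h r).
Proof.
elim: s h => [|e s IHs] h /=; first by move=> ->; rewrite ract0l.
by move=> [t ht]; exists (t * r); rewrite -ractM -ractBl; exact: IHs.
Qed.

Lemma span_cons e s h : span s h -> span (e :: s) h.
Proof. by exists 0; rewrite ract0r subr0. Qed.

Lemma span_perm s s' : Permutation s s' -> forall h, span s h -> span s' h.
Proof.
elim=> //= {s s'}.
- by move=> e s s' _ IHs h [r hr]; exists r; exact: IHs.
- by move=> e f s h [r [t hrt]]; exists t, r; rewrite addrAC.
- by move=> s1 s2 s3 _ IH1 _ IH2 h /IH1/IH2.
Qed.

Lemma span_perm_iff s s' : Permutation s s' -> forall h, span s h <-> span s' h.
Proof.
by move=> ss' h; split; apply: span_perm => //; exact: Permutation_sym.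
Qed.

End RightAction.

(** * Euclid's algorithm and the order of a generating sequence *)

Definition generates_ideal (R : nzRingType) (a : R) (I : R -> Prop) : Prop :=
  forall x, I x <-> exists r, x = a * r.

Section EuclideanOrder.
Variables (R : nzRingType) (A : groupType) (chi : R -> A).
Hypothesis mulC : forall x y : A, (x * y = y * x)%g.
Hypothesis mulR_neq0 : forall x y : R, x != 0 -> y != 0 -> x * y != 0.
Hypothesis chiM : forall x y : R, x != 0 -> y != 0 -> chi (x * y) = (chi x * chi y)%g.

Variable size_le : nat -> R -> Prop.
Hypothesis size_le0 : forall x, size_le 0 x -> x = 0.
Hypothesis size_le_exists : forall x, exists n, size_le n x.
Hypothesis right_division : forall n a c,
  size_le n.+1 a -> a != 0 -> exists q, size_le n (c - a * q).

Lemma mulR_eq0 (x y : R) : x != 0 -> x * y = 0 -> y = 0.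
Proof.
move=> x0 xy; apply/eqP; apply: contraT => y0.
by have := mulR_neq0 x0 y0; rewrite xy eqxx.
Qed.

Lemma mulRI (x y z : R) : x != 0 -> x * y = x * z -> y = z.
Proof.
move=> x0 /eqP; rewrite -subr_eq0 -mulrBr => /eqP /(mulR_eq0 x0) /eqP.
by rewrite subr_eq0 => /eqP.
Qed.

(* If c u = a v generates the intersection of aR and cR, then chi a is        *)
(* chi g * chi u iff chi c is chi g * chi v, so the claim for (a, c) follows  *)
(* from the one for (c mod a, a) by Euclid's algorithm.                       *)
Lemma gcd_colon (a c : R) : a != 0 ->
  exists g u, [/\ g != 0, u != 0, chi a = (chi g * chi u)%g,
    generates_ideal g (fun x => exists r s, x = a * r + c * s) &
    generates_ideal u (fun x => exists r, c * x = a * r)].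
Proof.
have [n] := size_le_exists a.
elim: n a c => [|n IHn] a c; first by move=> /size_le0 ->; rewrite eqxx.
move=> an a0; have [q rn] := right_division c an a0.
have cE : c = a * q + (c - a * q) by rewrite addrC subrK.
move: (c - a * q) rn cE => r rn cE.
case: (eqVneq r 0) => [r0|r0].
  exists a, 1; split; rewrite ?oner_neq0 //.
  - by rewrite -{1}[a]mulr1 chiM // oner_neq0.
  - move=> x; split=> [[y [z ->]]|[y ->]].
      by exists (y + q * z); rewrite cE r0 addr0 mulrDr mulrA.
    by exists y, 0; rewrite mulr0 addr0.
  - move=> x; split=> [_|[y ->]]; first by exists x; rewrite mul1r.
    by exists (q * y); rewrite cE r0 addr0 mul1r mulrA.
have [g [v [g0 v0 chi_r gE vE]]] := IHn r a rn r0.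
(* [u] is the cofactor in the common multiple [a * v = r * u]. Applying [chi], inserting the
   induction hypothesis for [chi r] and cancelling [chi v] gives the identity for [chi a]. *)
have [|u avE] := (vE v).2; first by exists 1; rewrite mulr1.
have u0 : u != 0.
  by apply: contraNneq (mulR_neq0 a0 v0) => u0; rewrite avE u0 mulr0.
exists g, u; split=> //.
- apply: (mulIg (chi v)); rewrite -chiM // avE chiM // chi_r.
  by rewrite -!mulgA [(chi v * _)%g]mulC.
- move=> x; rewrite -gE; split=> -[y [z ->]].
    exists z, (y + q * z); rewrite cE mulrDr mulrDl !mulrA.
    by rewrite addrA addrC.
  exists (z - q * y), y; rewrite cE mulrDl mulrBr mulrA.
  by rewrite addrA subrK addrC.
- move=> x; split=> [[y cxE]|[w ->]].
    have rxE : a * (y - q * x) = r * x.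
      by rewrite mulrBr -cxE cE mulrDl mulrA addrAC subrr add0r.
    have [|w yE] := (vE (y - q * x)).1; first by exists x.
    exists w; apply: (mulRI r0).
    by rewrite -rxE yE !mulrA avE.
  by exists (q * u * w + v * w); rewrite cE mulrDl mulrDr !mulrA avE.
Qed.

Lemma right_ore (a c : R) : a != 0 -> exists2 u, u != 0 & exists r, c * u = a * r.
Proof.
move=> /(gcd_colon c) [g [u [_ u0 _ _ uE]]]; exists u => //.
by apply/uE; exists 1; rewrite mulr1.
Qed.

Definition invertible (u : R) : Prop := exists v, u * v = 1 /\ v * u = 1.

Lemma invertible_neq0 u : invertible u -> u != 0.
Proof. by move=> [v [uv _]]; apply: contra_eq_neq uv => ->; rewrite mul0r eq_sym oner_eq0. Qed.

Lemma chi1 : chi 1 = 1%g.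
Proof. by apply: (mulIg (chi 1)); rewrite -chiM ?oner_neq0 // mulr1 mul1g. Qed.

(** Generators of one right ideal of a domain differ by a unit on the right; commutativity of [A]
    lets such factors be collected at the end. *)
Definition equal_mod_units (x y : A) : Prop :=
  exists2 u, invertible u & x = (y * chi u)%g.

Lemma equal_mod_units_refl x : equal_mod_units x x.
Proof. by exists 1; [exists 1; rewrite mulr1 | rewrite chi1 mulg1]. Qed.

Lemma equal_mod_units_trans x y z :
  equal_mod_units x y -> equal_mod_units y z -> equal_mod_units x z.
Proof.
move=> [u [u' [uu' u'u]] ->] [v [v' [vv' v'v]] ->]; exists (v * u).
  exists (u' * v'); rewrite !mulrA -(mulrA v) uu' mulr1 vv'.
  by rewrite -(mulrA u') v'v mulr1 u'u.
by rewrite chiM ?mulgA //; apply: invertible_neq0; [exists v'|exists u'].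
Qed.

Lemma equal_mod_unitsM x x' y y' :
  equal_mod_units x x' -> equal_mod_units y y' -> equal_mod_units (x * y)%g (x' * y')%g.
Proof.
move=> xx' [v vU ->]; apply: (@equal_mod_units_trans _ (x * y')%g).
  by exists v; rewrite ?mulgA.
have [u uU ->] := xx'; exists u => //.
by rewrite -!mulgA (mulC y').
Qed.

Lemma generator_unique (I : R -> Prop) (a b : R) : a != 0 ->
  generates_ideal a I -> generates_ideal b I -> equal_mod_units (chi a) (chi b).
Proof.
move=> a0 aI bI.
have [r aE] : exists r, a = b * r by apply/bI/aI; exists 1; rewrite mulr1.
have [s bE] : exists s, b = a * s by apply/aI/bI; exists 1; rewrite mulr1.
have b0 : b != 0 by apply: contraNneq a0 => b0; rewrite aE b0 mul0r.
have rU : invertible r.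
  exists s; split.
    by apply: (mulRI b0); rewrite mulrA -aE -bE mulr1.
  by apply: (mulRI a0); rewrite mulrA -bE -aE mulr1.
by exists r => //; rewrite {1}aE chiM // invertible_neq0.
Qed.

Variable H : lmodType R^c.

Definition colon (N : H -> Prop) (e : H) : R -> Prop := fun r => N (ract e r).

(* The head of the list is the generator added last.                          *)
Inductive chain_order : seq H -> A -> Prop :=
| chain_order_nil : chain_order [::] 1%g
| chain_order_cons e s a x : chain_order s x -> a != 0 ->
    generates_ideal a (colon (span s) e) -> chain_order (e :: s) (chi a * x)%g.

(** Both derivations use the same colon ideals, so their factors differ only in the choice of
    generators. *)
Lemma chain_order_unique s x y :
  chain_order s x -> chain_order s y -> equal_mod_units x y.
Proof.
move=> sx; elim: sx y => {s x} [|e s a x _ IHs a0 aE] y.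
  by move=> sy; inversion sy; exact: equal_mod_units_refl.
move=> sy; inversion sy as [|e' s' b z sz b0 bE]; subst.
by apply: equal_mod_unitsM; [exact: generator_unique a0 aE bE|exact: IHs].
Qed.

Lemma generates_ideal_ext (a : R) (I J : R -> Prop) :
  (forall x, I x <-> J x) -> generates_ideal a I -> generates_ideal a J.
Proof. by move=> IJ aI x; rewrite -IJ. Qed.

(* The pairs (t, r) with f t - e r in span s are the combinations of (b, c)   *)
(* and (0, a). With aR + cR = gR and {w | c w \in aR} = uR, the generators    *)
(* after the exchange are b u and g instead of a and b.                       *)
Lemma chain_order_swap e f s x :
  chain_order [:: f, e & s] x -> chain_order [:: e, f & s] x.
Proof.
move=> fes; inversion fes as [|f' s' b x' es b0 bE]; subst => {fes}.
inversion es as [|e' s' a y sy a0 aE]; subst => {es}.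
have [c bc] : span (e :: s) (ract f b) by apply/bE; exists 1; rewrite mulr1.
have [g [u [g0 u0 chi_a gE uE]]] := gcd_colon c a0.
(* Splitting [chi a] as [chi g * chi u] and commuting trades the factors [chi b] and [chi a] for
   [chi g] and [chi (b * u)]. *)
rewrite mulgA [(chi b * _)%g]mulC chi_a -(mulgA (chi g)) [(chi u * _)%g]mulC.
rewrite -chiM // -mulgA.
have bcr w : span s (ract f (b * w) - ract e (c * w)).
  by rewrite -!ractM -ractBl; exact: span_ract.
have K r t : span s (ract f t - ract e r) <->
    exists w z, t = b * w /\ r = c * w + a * z.
  split=> [frt|[w [z [-> ->]]]]; last first.
    rewrite ractDr opprD addrA; apply: spanB; first exact: bcr.
    by apply/aE; exists z.
  have [|w tE] := (bE t).1; first by exists r.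
  have [|z zE] := (aE (r - c * w)).1.
    have := spanB (bcr w) frt; rewrite /colon ractBr tE.
    by rewrite opprB addrC addrA subrK.
  by exists w, z; rewrite -zE addrC subrK.
constructor => //; first constructor; rewrite ?mulR_neq0 //.
- move=> t; split=> [ft|[r ->]].
    have [|w [z [tE]]] := (K 0 t).1; first by rewrite ract0r subr0.
    move=> czE; have [|r wE] := (uE w).1.
      exists (- z); apply/eqP; rewrite mulrN -addr_eq0; exact/eqP/esym.
    by exists r; rewrite tE wE mulrA.
  have [|z zE] := (uE (u * r)).2; first by exists r.
  have [_ /(_ _)] := K 0 (b * u * r); rewrite ract0r subr0; apply.
  by exists (u * r), (- z); rewrite mulrA mulrN zE subrr.
- apply: generates_ideal_ext gE => r; split=> [[z [w ->]]|[t ert]].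
    exists (b * w); rewrite -opprB -[- _]add0r; apply: spanB; first exact: span0.
    by apply/K; exists w, z; rewrite addrC.
  have [|w [z [_ ->]]] := (K r t).1; last by exists z, w; rewrite addrC.
  by rewrite -opprB -[- _]add0r; apply: spanB => //; exact: span0.
Qed.

Lemma chain_order_perm s s' : Permutation s s' ->
  forall x, chain_order s x -> chain_order s' x.
Proof.
elim=> {s s'} // [e s s' ss' IHs|f e s|s1 s2 s3 _ IH1 _ IH2] x.
- move=> sx; inversion sx as [|e' s'' a y sy a0 aE]; subst.
  constructor=> //; first exact: IHs.
  by apply: generates_ideal_ext aE => r; exact: span_perm_iff.
- exact: chain_order_swap.
- by move=> /IH1/IH2.
Qed.

(** Over a sequence that already spans [H], every colon ideal is the whole ring, generated by 1, and
    [chi 1] is trivial. *)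
Lemma chain_order_cat s t x : (forall h, span s h) ->
  chain_order s x -> chain_order (t ++ s) x.
Proof.
move=> sH sx; elim: t => [//|e t IHt].
have tsH h : span (t ++ s) h by elim: t {IHt} => [|f t IHt] /=; [|exact: span_cons].
rewrite -[x]mul1g -chi1; constructor=> //; first exact: oner_neq0.
by move=> r; split=> _ //; exists r; rewrite mul1r.
Qed.

Lemma chain_order_generators_unique s t x y :
  (forall h, span s h) -> (forall h, span t h) ->
  chain_order s x -> chain_order t y -> equal_mod_units x y.
Proof.
move=> sH tH sx ty; apply: (@chain_order_unique (s ++ t)).
  by apply: chain_order_perm (chain_order_cat t sH sx); exact: Permutation_app_comm.
exact: chain_order_cat.
Qed.

End EuclideanOrder.

(** * Order and torsion of a direct sum of cyclic modules *)

Section CyclicDecomposition.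
Variables (R : nzRingType) (H : lmodType R^c) (l : nat) (p : 'I_l -> R).
Variable phi : {linear H -> direct_sum (fun i => cyclic_module (p i) : lmodType R^c)}.
Hypothesis phi_bij : bijective phi.

Lemma coordB (h h' : H) i : phi (h - h') i = phi h i - phi h' i.
Proof. by rewrite raddfB [LHS]ffunE [X in _ + X]ffunE. Qed.

Lemma coord_ract (h : H) r i : phi (ract h r) i = (r : R^c) *: phi h i.
Proof. by rewrite /ract linearZ [LHS]ffunE. Qed.

Lemma coord0 i : phi 0 i = 0.
Proof. by rewrite raddf0 [LHS]ffunE. Qed.

Lemma coord_eq0 h : (forall i, phi h i = 0) -> h = 0.
Proof.
move=> h0; apply: (bij_inj phi_bij); apply/ffunP => i.
by rewrite h0 coord0.
Qed.

Lemma cyclic_class_ract (a x r : R) :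
  (r : R^c) *: cyclic_class a x = cyclic_class a (x * r).
Proof. exact: cyclic_scaleE. Qed.

Lemma cyclic_class_eq0 (a x : R) : cyclic_class a x = 0 <-> exists r, x = a * r.
Proof.
rewrite -(raddf0 (cyclic_class a)); split => [/cyclic_class_eq|[r xE]].
  by rewrite subr0.
by apply/cyclic_class_eq; exists r; rewrite subr0.
Qed.

Lemma cyclic_class_surj (a : R) (m : cyclic_module a) : exists x, m = cyclic_class a x.
Proof. by exists (repr (m : Quotient.quot (right_ideal a))); rewrite cyclic_classK. Qed.

(** The preimages of the standard generators; quantifying over all multiples [r] builds linearity
    into the formula. *)
Definition is_cyclic_basis (e : 'I_l -> H) : Prop := forall i j r,
  phi (ract (e i) r) j = if j == i then cyclic_class (p j) r else 0.

Lemma cyclic_basis_exists : exists e, is_cyclic_basis e.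
Proof.
have [psi _ psiK] := phi_bij.
exists (fun i => psi [ffun j => if j == i then cyclic_class (p j) 1 else 0]) => i j r.
rewrite coord_ract psiK ffunE; case: eqP => _; last exact: scaler0.
by rewrite cyclic_class_ract mul1r.
Qed.

Variable e : 'I_l -> H.
Hypothesis eP : is_cyclic_basis e.

Lemma span_basis_coord (s : seq 'I_l) h j :
  span [seq e i | i <- s] h -> j \notin s -> phi h j = 0.
Proof.
elim: s h => [|i s IHs] h /=; first by move=> ->; rewrite coord0.
move=> [r hs]; rewrite inE negb_or => /andP[ji js].
by have := IHs _ hs js; rewrite coordB eP (negPf ji) subr0.
Qed.

Lemma coord_span_basis (s : seq 'I_l) h :
  (forall j, j \notin s -> phi h j = 0) -> span [seq e i | i <- s] h.
Proof.
elim: s h => [|i s IHs] h hs /=; first by apply: coord_eq0 => j; exact: hs.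
have [x hx] := cyclic_class_surj (phi h i).
exists x; apply: IHs => j js; rewrite coordB eP.
case: eqP => [->|/eqP ji]; first by rewrite hx subrr.
by rewrite hs ?subr0 // inE negb_or ji.
Qed.

Lemma basis_span h : span [seq e i | i <- index_enum 'I_l] h.
Proof. by apply: coord_span_basis => j; rewrite mem_index_enum. Qed.

Lemma colon_basis (s : seq 'I_l) i : i \notin s ->
  generates_ideal (p i) (colon (span [seq e j | j <- s]) (e i)).
Proof.
move=> is_ r; split=> [/span_basis_coord/(_ is_)|].
  by rewrite eP eqxx => /cyclic_class_eq0.
move=> /cyclic_class_eq0 r0; apply: coord_span_basis => j _.
by rewrite eP; case: eqP => // ->.
Qed.

(** By directness of the sum, the colon ideal of [e i] over the other basis elements is generated by
    [p i], so the chain reproduces the product factor by factor. *)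
Lemma chain_order_basis (A : groupType) (chi : R -> A) :
  chi 1 = 1%g -> (forall x y : R, x != 0 -> y != 0 -> x * y != 0) ->
  (forall x y : R, x != 0 -> y != 0 -> chi (x * y) = (chi x * chi y)%g) ->
  (forall i, p i != 0) ->
  chain_order chi [seq e i | i <- index_enum 'I_l] (chi (\prod_(i < l) p i)).
Proof.
move=> chi1 mulR_neq0 chiM p0.
elim: (index_enum 'I_l) (index_enum_uniq 'I_l) => [_|i s IHs /=].
  by rewrite big_nil chi1; constructor.
move=> /andP[is_ /IHs {}IHs]; rewrite big_cons chiM //; last first.
  elim: (s) => [|j t IHt]; rewrite ?big_nil ?oner_neq0 // big_cons.
  exact: mulR_neq0.
by constructor => //; exact: colon_basis.
Qed.

Lemma torsion_cyclic_sum :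
  (forall a c : R, a != 0 -> exists2 u, u != 0 & exists r, c * u = a * r) ->
  (forall x y : R, x != 0 -> y != 0 -> x * y != 0) ->
  (forall i, p i != 0) -> torsion_module H.
Proof.
move=> ore mulR_neq0 p0 h.
(* Coordinates are killed one at a time: the Ore condition moves a representative [x] of the current
   coordinate into the right ideal of [p i], and coordinates already zero stay zero. *)
have [r r0 hr] : exists2 r, r != 0 & forall i, i \in index_enum 'I_l -> phi (ract h r) i = 0.
  elim: (index_enum 'I_l) => [|i s [r r0 hr]]; first by exists 1; rewrite ?oner_neq0.
  have [x hx] := cyclic_class_surj (phi (ract h r) i).
  have [u u0 xu] := ore (p i) x (p0 i).
  exists (r * u); first exact: mulR_neq0.
  move=> j; rewrite -ractM coord_ract inE => /orP[/eqP ->|/hr ->]; last exact: scaler0.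
  by rewrite hx cyclic_class_ract; apply/cyclic_class_eq0.
by exists r => //; apply: coord_eq0 => i; apply: hr; rewrite mem_index_enum.
Qed.

(** If [p i] were 0, the generator [e i] would have trivial annihilator. *)
Lemma torsion_cyclic_sum_neq0 : torsion_module H -> forall i, p i != 0.
Proof.
move=> tH i; apply/eqP => pi0; have [r r0 er0] := tH (e i).
have := eP i i r; rewrite eqxx [ract _ _]er0 coord0 => /esym /cyclic_class_eq0 [t].
by rewrite pi0 mul0r => /eqP; rewrite (negPf r0).
Qed.

End CyclicDecomposition.

(** * Multiplicativity of the class in the abelianized unit group *)

Section FractionClassTotal.
Variables (R : nzRingType) (Q : unitRingType) (iota : {rmorphism R -> Q}).
Hypothesis hQ : quotient_skew_field iota.

Lemma quotient_skew_field_mul_neq0 (x y : R) : x != 0 -> y != 0 -> x * y != 0.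
Proof.
move=> /(frac_unit hQ) xu /(frac_unit hQ) yu; apply/eqP => xy0.
by have := unitrMl (iota x) yu; rewrite -rmorphM xy0 rmorph0 unitr0 xu.
Qed.

(* Junk value at 0: the class of 1. *)
Definition frac_class_total (x : R) : abelianization (unit_group Q) :=
  ab_class (insubd (exist _ 1 (unitr1 Q) : {q : Q | q \is a GRing.unit}) (iota x)
            : unit_group Q).

Lemma frac_class_totalE (x : R) (x0 : x != 0) : frac_class_total x = frac_class hQ x0.
Proof.
congr ab_class; apply: val_inj; rewrite [LHS]val_insubd.
by rewrite (frac_unit hQ x0).
Qed.

Lemma frac_class_totalM (x y : R) : x != 0 -> y != 0 ->
  frac_class_total (x * y) = (frac_class_total x * frac_class_total y)%g.
Proof.
move=> x0 y0; have xy0 := quotient_skew_field_mul_neq0 x0 y0.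
rewrite !frac_class_totalE -ab_classM; congr ab_class.
by apply: val_inj; rewrite /= rmorphM.
Qed.

End FractionClassTotal.

Theorem theorem3p1
  (K : unitRingType) (K_skew_field : GRing.field_axiom K)
  (gamma : {rmorphism K -> K}) (gamma_bij : bijective gamma)
  (Q : unitRingType) (iota : {rmorphism skew_laurent gamma_bij -> Q})
  (Q_quotient : quotient_skew_field iota)
  (H : lmodType (skew_laurent gamma_bij)^c) (H_fg : finitely_generated H) :
  (forall d : skew_laurent gamma_bij, is_order H d ->
     (d = 0 <-> ~ torsion_module H)) /\
  (forall d d' : skew_laurent gamma_bij, is_order H d -> is_order H d' ->
     forall (d_neq0 : d != 0) (d'_neq0 : d' != 0),
     exists (k : K) (e : int) (k_neq0 : k != 0),
       frac_class Q_quotient d_neq0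
       = (frac_class Q_quotient d'_neq0
          * frac_class Q_quotient (laurent_mono_neq0 gamma_bij e k_neq0))%g).

Proof.
have mulR_neq0 := quotient_skew_field_mul_neq0 Q_quotient.
have chiM := frac_class_totalM Q_quotient.
have width0 := @width_le0 K gamma gamma_bij.
have widthE := @width_le_exists K gamma gamma_bij.
have division := @laurent_right_division K gamma K_skew_field gamma_bij.
have mulC : forall x y : abelianization (unit_group Q), (x * y = y * x)%g by exact: ab_mulC.
have chi1_ := chi1 chiM.
split=> [d [l [p [phi [phi_bij ->]]]]|
         d d' [l [p [phi [phi_bij ->]]]] [l' [p' [phi' [phi'_bij ->]]]] d0 d'0].
  have [e eP] := cyclic_basis_exists phi_bij.
  split=> [d0 tH|ntH].
    have p0 := torsion_cyclic_sum_neq0 eP tH.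
    suff : \prod_(i < l) p i != 0 by rewrite d0 eqxx.
    by apply: (big_ind (fun x => x != 0)) => //; exact: oner_neq0.
  apply/eqP; apply: contra_notT ntH => d0.
  apply: (torsion_cyclic_sum phi_bij _ mulR_neq0 (prod_factor_neq0 d0)) => a c.
  exact: (right_ore mulC mulR_neq0 chiM width0 widthE division).
have [e eP] := cyclic_basis_exists phi_bij.
have [e' eP'] := cyclic_basis_exists phi'_bij.
have [u [v [uv _]]] := chain_order_generators_unique
  mulC mulR_neq0 chiM width0 widthE division
  (basis_span phi_bij eP) (basis_span phi'_bij eP')
  (chain_order_basis phi_bij eP chi1_ mulR_neq0 chiM (prod_factor_neq0 d0))
  (chain_order_basis phi'_bij eP' chi1_ mulR_neq0 chiM (prod_factor_neq0 d'0)).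
(* The discrepancy between the two orders is the class of a unit [u], hence of a monomial. *)
have [k [n [k0 uE]]] := laurent_unit_mono K_skew_field uv.
move=> dE; exists k, n, k0; rewrite -!frac_class_totalE dE.
by rewrite uE.
Qed.
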